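(* Let $(M,F(\alpha,\beta))$ be a non-Riemannian Finsler space of dimension $n\ge 3$, where $F=\alpha\,\phi(s)$, $s=\beta/\alpha$, is an $(\alpha,\beta)$-metric and $\beta$ is a closed $1$-form on $M$. Then in each of the following cases $F$ is with reversible geodesics: (i) $\phi(s)=s^2+2s+2$; (ii) $\phi(s)=s^2+s+2$; (iii) $\phi(s)=(s+2)^2$.
   Context: $M$ is a connected smooth manifold. A Finsler metric on $M$ is a function $F:TM\to[0,\infty)$ that is $C^\infty$ on $TM\setminus\{0\}$, satisfies $F(x,\lambda y)=\lambda F(x,y)$ for $\lambda>0$, and for which the matrix $\left(\left[\tfrac12F^2\right]_{y^iy^j}\right)$ is positive definite at every $(x,y)$ with $y\neq0$; $(M,F)$ is then called a Finsler space. An $(\alpha,\beta)$-metric is a Finsler metric $F=\alpha\,\phi(\beta/\alpha)$, with $\alpha=\sqrt{a_{ij}(x)y^iy^j}$ a Riemannian metric, $\beta=b_i(x)y^i$ a $1$-form on $M$ and $\phi$ a $C^\infty$ function; throughout, the length of $\beta$ with respect to $\alpha$ satisfies $\|\beta_x\|_\alpha<1$ for all $x$. The reverse metric of $F$ is $\bar F(x,y)=F(x,-y)$. $F$ is said to be with reversible geodesics if $F$ and $\bar F$ are projectively equivalent, i.e. the geodesics of $F$ and of $\bar F$ coincide as point sets (as unparametrized curves); equivalently, for any oriented geodesic path of $F$, the same path traversed in the opposite sense is also a geodesic of $F$. *)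

(* Defs.v *)
From HB Require Import structures.
From mathcomp Require Import all_boot all_order all_algebra.
From mathcomp Require Import all_classical all_reals all_analysis.
Set Implicit Arguments.
Unset Strict Implicit.
Unset Printing Implicit Defensive.
Import Order.TTheory GRing.Theory Num.Theory.
Import numFieldNormedType.Exports.
Local Open Scope classical_set_scope.
Local Open Scope ring_scope.

(* For [A] open and [V] finite-dimensional, this is the usual class C^k on [A]. *)
Fixpoint Ck_on (R : realType) (V W : normedModType R) (k : nat)
    (A : set V) (f : V -> W) : Prop :=
  match k with
  | 0 => forall x, A x -> {for x, continuous f}
  | k'.+1 => (forall x, A x -> differentiable f x) /\
             (forall v : V, Ck_on k' A (fun x => 'D_v f x))
  end.

Definition smooth_on (R : realType) (V W : normedModType R)
    (A : set V) (f : V -> W) : Prop :=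
  forall k, Ck_on k A f.

Definition basis_vec (R : realType) (n : nat) (k : 'I_n) : 'rV[R]_n :=
  delta_mx 0 k.

(* A smooth structure of dimension [n] is given by an atlas, together with a
   preferred chart [chart_at p] around every point [p] (so the domains cover).
   Charts and their inverses are total functions, only meaningful on
   [chart_dom i] and on [chart i @` chart_dom i] respectively. *)
Record smooth_manifold (R : realType) (n : nat) (M : topologicalType) := {
  chart_idx : Type ;
  chart_dom : chart_idx -> set M ;
  chart : chart_idx -> M -> 'rV[R]_n ;
  chart_inv : chart_idx -> 'rV[R]_n -> M ;
  chart_at : M -> chart_idx ;
  manifold_hausdorff : hausdorff_space M ;
  manifold_second_countable : @second_countable M ;
  chart_dom_open : forall i, open (chart_dom i) ;
  chart_image_open : forall i, open (chart i @` chart_dom i) ;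
  chartK : forall i p, chart_dom i p -> chart_inv i (chart i p) = p ;
  chart_continuous : forall i p, chart_dom i p ->
    {for p, continuous (chart i)} ;
  chart_inv_continuous : forall i x, (chart i @` chart_dom i) x ->
    {for x, continuous (chart_inv i)} ;
  chart_at_dom : forall p, chart_dom (chart_at p) p ;
  chart_transition_smooth : forall i j,
    smooth_on (chart i @` (chart_dom i `&` chart_dom j))
              (chart j \o chart_inv i)
}.

(* The tangent space at [p] is R^n, a vector being identified with its
   components in the preferred chart [chart_at p]. Thus TM is [M * 'rV[R]_n],
   and a function on TM is a function of the following type. *)
Definition TM_fun (R : realType) (n : nat) (M : topologicalType) :=
  M -> 'rV[R]_n -> R.

(* [tvec X i x y] is the vector y^k d/dx^k at the point of coordinates [x] in
   the chart [i], i.e. the tangent vector with components [y] in that chart. *)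
Definition tvec (R : realType) (n : nat) (M : topologicalType)
    (X : smooth_manifold R n M) (i : chart_idx X) (x y : 'rV[R]_n) : 'rV[R]_n :=
  'd (chart (chart_at X (chart_inv i x)) \o chart_inv i) x y.

(* The local expression F(x, y) of a function on TM in the chart [i]. *)
Definition local_expr (R : realType) (n : nat) (M : topologicalType)
    (X : smooth_manifold R n M) (F : TM_fun R n M) (i : chart_idx X)
    (z : 'rV[R]_n * 'rV[R]_n) : R :=
  F (chart_inv i z.1) (tvec i z.1 z.2).

(* The image of TM \ {0} in the chart of TM induced by [i]. *)
Definition slit_chart_image (R : realType) (n : nat) (M : topologicalType)
    (X : smooth_manifold R n M) (i : chart_idx X) :
    set ('rV[R]_n * 'rV[R]_n) :=
  [set z | (chart i @` chart_dom i) z.1 /\ z.2 != 0].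

Definition dx (R : realType) (n : nat) (k : 'I_n)
    (f : 'rV[R]_n * 'rV[R]_n -> R) (z : 'rV[R]_n * 'rV[R]_n) : R :=
  'D_(basis_vec R k, 0) f z.

Definition dy (R : realType) (n : nat) (k : 'I_n)
    (f : 'rV[R]_n * 'rV[R]_n -> R) (z : 'rV[R]_n * 'rV[R]_n) : R :=
  'D_(0, basis_vec R k) f z.

(* g_ij = [F^2 / 2]_{y^i y^j} *)
Definition fundamental_tensor (R : realType) (n : nat) (M : topologicalType)
    (X : smooth_manifold R n M) (F : TM_fun R n M) (i : chart_idx X)
    (z : 'rV[R]_n * 'rV[R]_n) : 'M[R]_n :=
  \matrix_(k, l) dy l (dy k (fun w => local_expr F i w ^+ 2 / 2)) z.

Definition positive_definite (R : realType) (n : nat) (g : 'M[R]_n) : Prop :=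
  forall v : 'rV[R]_n, v != 0 -> 0 < (v *m g *m v^T) 0 0.

Record finsler_metric (R : realType) (n : nat) (M : topologicalType)
    (X : smooth_manifold R n M) (F : TM_fun R n M) : Prop := {
  finsler_ge0 : forall p v, 0 <= F p v ;
  finsler_smooth : forall i : chart_idx X,
    smooth_on (slit_chart_image i) (local_expr F i) ;
  finsler_homogeneous : forall p v (l : R), 0 < l -> F p (l *: v) = l * F p v ;
  finsler_convex : forall (i : chart_idx X) z, slit_chart_image i z ->
    positive_definite (fundamental_tensor F i z)
}.

Record riemannian_metric (R : realType) (n : nat) (M : topologicalType)
    (X : smooth_manifold R n M) := {
  inner :> M -> 'rV[R]_n -> 'rV[R]_n -> R ;
  inner_linear : forall p u, linear (inner p u : 'rV[R]_n -> R^o) ;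
  inner_sym : forall p u v, inner p u v = inner p v u ;
  inner_pos : forall p v, v != 0 -> 0 < inner p v v ;
  inner_smooth : forall (i : chart_idx X) (k l : 'I_n),
    smooth_on (chart i @` chart_dom i)
      (fun x => inner (chart_inv i x) (tvec i x (basis_vec R k))
                                      (tvec i x (basis_vec R l)))
}.

Definition riemannian_norm (R : realType) (n : nat) (M : topologicalType)
    (X : smooth_manifold R n M) (a : riemannian_metric X) : TM_fun R n M :=
  fun p v => Num.sqrt (a p v v).

Definition is_riemannian (R : realType) (n : nat) (M : topologicalType)
    (X : smooth_manifold R n M) (F : TM_fun R n M) : Prop :=
  exists a : riemannian_metric X, forall p v, F p v = riemannian_norm a p v.

(* The components of a 1-form in the chart [i]. *)
Definition form_comp (R : realType) (n : nat) (M : topologicalType)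
    (X : smooth_manifold R n M) (b : TM_fun R n M) (i : chart_idx X) (k : 'I_n)
    (x : 'rV[R]_n) : R :=
  b (chart_inv i x) (tvec i x (basis_vec R k)).

Record one_form (R : realType) (n : nat) (M : topologicalType)
    (X : smooth_manifold R n M) := {
  form_val :> M -> 'rV[R]_n -> R ;
  form_linear : forall p, linear (form_val p : 'rV[R]_n -> R^o) ;
  form_smooth : forall (i : chart_idx X) (k : 'I_n),
    smooth_on (chart i @` chart_dom i) (form_comp form_val i k)
}.

Definition closed_form (R : realType) (n : nat) (M : topologicalType)
    (X : smooth_manifold R n M) (b : one_form X) : Prop :=
  forall (i : chart_idx X) (k l : 'I_n) x, (chart i @` chart_dom i) x ->
    'D_(basis_vec R k) (form_comp b i l) x =
    'D_(basis_vec R l) (form_comp b i k) x.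

(* The norm of the linear form b_p, dual to the Euclidean norm a_p. *)
Definition form_norm (R : realType) (n : nat) (M : topologicalType)
    (X : smooth_manifold R n M) (a : riemannian_metric X) (b : one_form X)
    (p : M) : R :=
  sup [set `|b p v| | v in [set v | riemannian_norm a p v <= 1]].

(* [phi] is only ever evaluated on ]-1, 1[, as |b| / |a| < 1. On the zero
   section the formula reads 0 * phi (0 / 0) = 0. *)
Definition alpha_beta_metric (R : realType) (n : nat) (M : topologicalType)
    (X : smooth_manifold R n M) (phi : R -> R) (a : riemannian_metric X)
    (b : one_form X) (F : TM_fun R n M) : Prop :=
  [/\ finsler_metric X F,
      smooth_on (V := R) (W := R) `]-1, 1[%classic phi,
      forall p, form_norm a b p < 1 &
      forall p v, F p v =
        riemannian_norm a p v * phi (b p v / riemannian_norm a p v)].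

(* G^k = 1/4 g^{kl} ([F^2]_{x^m y^l} y^m - [F^2]_{x^l}) *)
Definition spray_coef (R : realType) (n : nat) (M : topologicalType)
    (X : smooth_manifold R n M) (F : TM_fun R n M) (i : chart_idx X)
    (z : 'rV[R]_n * 'rV[R]_n) : 'rV[R]_n :=
  let F2 := fun w => local_expr F i w ^+ 2 in
  \row_k (4^-1 * \sum_l invmx (fundamental_tensor F i z) k l *
           ((\sum_m dx m (dy l F2) z * z.2 0 m) - dx l F2 z)).

(* Regular curves solving c'' + 2 G(c, c') = 0 in every chart. Twice
   differentiable solutions are automatically C^oo, as G is. *)
Definition geodesic (R : realType) (n : nat) (M : topologicalType)
    (X : smooth_manifold R n M) (F : TM_fun R n M) (I : set R) (c : R -> M) :
    Prop :=
  [/\ open I, is_interval I,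
      forall t, I t -> {for t, continuous c} &
      forall (i : chart_idx X) t, I t -> chart_dom i (c t) ->
        let x : R -> 'rV[R]_n := chart i \o c in
        [/\ derivable x t 1, derivable (derive1 x) t 1, derive1 x t != 0 &
            derive1 (derive1 x) t + 2 *: spray_coef F i (x t, derive1 x t) = 0]].

(* Oriented change of parameter from the open interval [J] onto [I]. When [c] and
   [c \o s] are both geodesics, [s] is automatically C^oo. *)
Definition reparametrization (R : realType) (J I : set R) (s : R -> R) : Prop :=
  [/\ open J, is_interval J, s @` J = I &
      forall t, J t -> derivable s t 1 /\ 0 < derive1 s t].

(* Same unparametrized geodesics, as oriented paths. The orientation matters:
   without it every F would be projectively equivalent to its reverse, since
   traversing a geodesic of F backwards always gives a geodesic of the
   reverse metric. *)
Definition projectively_equivalent (R : realType) (n : nat)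
    (M : topologicalType) (X : smooth_manifold R n M) (F1 F2 : TM_fun R n M) :
    Prop :=
  (forall I c, geodesic X F1 I c ->
     exists J s, reparametrization J I s /\ geodesic X F2 J (c \o s)) /\
  (forall I c, geodesic X F2 I c ->
     exists J s, reparametrization J I s /\ geodesic X F1 J (c \o s)).

Definition reverse_metric (R : realType) (n : nat) (M : topologicalType)
    (F : TM_fun R n M) : TM_fun R n M :=
  fun p v => F p (- v).

Definition reversible_geodesics (R : realType) (n : nat) (M : topologicalType)
    (X : smooth_manifold R n M) (F : TM_fun R n M) : Prop :=
  projectively_equivalent X F (reverse_metric F).

(* Main.v *)
(* In all three cases [F = G + r beta] with [G = beta^2 / alpha + d alpha] even in
   the velocity, so that the reverse metric is [F - 2 r beta]. A curve is a
   geodesic of [F] iff [F] is constant along it and it satisfies the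
   Euler-Lagrange equations of [F] (not [F^2]). As [beta] is closed, these
   equations are the same for [F] and [F - 2 r beta], and being homogeneous they
   are preserved by oriented changes of parameter. Parametrizing a geodesic of one
   of the metrics by the arc length of the other gives a geodesic of the other. *)

Require Import Defs.
From HB Require Import structures.
From mathcomp Require Import all_boot all_order all_algebra.
From mathcomp Require Import all_classical all_reals all_analysis.
From mathcomp Require Import ring lra.
Set Implicit Arguments.
Unset Strict Implicit.
Unset Printing Implicit Defensive.
Import Order.TTheory GRing.Theory Num.Theory.
Import numFieldNormedType.Exports.
Local Open Scope classical_set_scope.
Local Open Scope ring_scope.

(** * Parametrization by arc length *)

(** Supplies a compact interval around both a base point and the current point, on which the
    fundamental theorem of calculus applies whichever of the two comes first. *)
Lemma open_interval_enlarge (R : realType) (I : set R) (t u : R) :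
  open I -> is_interval I -> I t -> I u ->
  exists a b, [/\ a < t, a < u, t < b, u < b & `[a, b]%classic `<=` I].
Proof.
move=> oI iI It Iu.
have ends x : I x -> exists2 e, 0 < e & I (x - e) /\ I (x + e).
  move=> Ix; have /nbhs_ballP[e /= e0 xeI] : nbhs x I by exact: open_nbhs_nbhs.
  exists (e / 2); first by rewrite divr_gt0.
  have e2e : `|e / 2| < e by rewrite gtr0_norm; lra.
  split; apply: xeI; rewrite /ball/=.
    by rewrite (_ : x - (x - e / 2) = e / 2)//; ring.
  by rewrite (_ : x - (x + e / 2) = - (e / 2)) ?normrN//; ring.
have [d d0 [Itd1 Itd2]] := ends t It; have [e e0 [Iue1 Iue2]] := ends u Iu.
exists (Num.min (t - d) (u - e)), (Num.max (t + d) (u + e)); split.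
- by rewrite gt_min ltrBlDr ltrDl d0.
- by rewrite gt_min [X in _ || X]ltrBlDr ltrDl e0 orbT.
- by rewrite lt_max ltrDl d0.
- by rewrite lt_max [X in _ || X]ltrDl e0 orbT.
move=> x /=; rewrite in_itv/= => xab; apply: iI xab.
- by rewrite /Num.min; case: ifP.
- by rewrite /Num.max; case: ifP.
Qed.

Lemma continuous_antiderivative (R : realType) (I : set R) (h : R -> R) :
  open I -> is_interval I -> (forall t, I t -> {for t, continuous h}) ->
  exists sigma : R -> R, forall t, I t -> is_derive t 1 sigma (h t).
Proof.
move=> oI iI ch; have [->|/set0P[t0 It0]] := eqVneq I set0; first by exists h.
pose mu := @lebesgue_measure R.
(* One of the two domains is always empty, so this is the oriented integral from [t0] to [t]. *)
pose sigma t := (\int[mu]_(x in `]t0, t]) h x) - (\int[mu]_(x in `]t, t0]) h x).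
exists sigma => t It.
have [a [b [aT aT0 tb t0b abI]]] := open_interval_enlarge oI iI It It0.
have hint : mu.-integrable `[a, b] (EFin \o h).
  apply: continuous_compact_integrable; first exact: segment_compact.
  apply: continuous_in_subspaceT => x; rewrite inE => /abI.
  exact: ch.
have hintl x : x <= b -> mu.-integrable `[a, x] (EFin \o h).
  move=> xb; apply: integrableS hint => //; exact: subset_itvl.
have [dF F'] := continuous_FTC1_closed tb hint aT (ch _ It).
(* On []a, b[] the oriented integral differs only by a constant from the integral based at [a],
   whose derivative at [t] was just computed. *)
have sigmaE x : a < x -> x < b ->
    sigma x = \int[mu]_(y in `[a, x]) h y - \int[mu]_(y in `[a, t0]) h y.
  move=> ax xb; rewrite /sigma; have [t0x|xt0] := leP t0 x.
    rewrite [X in _ - X](_ : _ = 0); last first.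
      by rewrite set_itv_ge ?Rintegral_set0// bnd_simp -leNgt.
    rewrite subr0 Rintegral_itvB ?bnd_simp//; last exact: ltW.
    exact/hintl/ltW.
  rewrite [X in X - _](_ : _ = 0); last first.
    by rewrite set_itv_ge ?Rintegral_set0// bnd_simp -leNgt ltW.
  rewrite sub0r -[RHS]opprB Rintegral_itvB ?bnd_simp//; [|exact: ltW..].
  exact/hintl/ltW.
pose F := fun x => \int[mu]_(y in `[a, x]) h y - \int[mu]_(y in `[a, t0]) h y.
apply: (@near_eq_is_derive _ _ _ F).
  near=> x; rewrite [RHS]sigmaE//.
    by near: x; exact: lt_nbhsr.
  by near: x; exact: lt_nbhsl.
rewrite -[h t]subr0; apply: is_deriveB.
by split; [exact: dF|rewrite -derive1E].
Unshelve. all: by end_near. Qed.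

Lemma derive_gt0_incr (R : realType) (I : set R) (sigma h : R -> R) :
  is_interval I -> (forall t, I t -> is_derive t 1 sigma (h t)) ->
  (forall t, I t -> 0 < h t) ->
  forall t u, I t -> I u -> t < u -> sigma t < sigma u.
Proof.
move=> iI ds h0 t u It Iu tu.
have tuI x : x \in `[t, u] -> I x by rewrite in_itv/=; exact: iI.
apply: (@gtr0_derive1_lt_cc _ sigma t u) => //.
- by move=> x /subset_itv_oo_cc /tuI /ds [].
- by move=> x /subset_itv_oo_cc /tuI Ix; have [_] := ds _ Ix; rewrite derive1E => ->; exact: h0.
- by apply: derivable_within_continuous => x /tuI /ds [].
- by rewrite in_itv/= lexx ltW.
- by rewrite in_itv/= lexx ltW.
Qed.

(* The parameter [s] is the inverse of an antiderivative of [h]; when [h] is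
   the speed of a curve, it is the parametrization by arc length. *)
Lemma speed_reparametrization (R : realType) (I : set R) (h : R -> R) :
  open I -> is_interval I -> (forall t, I t -> {for t, continuous h}) ->
  (forall t, I t -> 0 < h t) ->
  exists J s, reparametrization J I s /\
    forall u, J u -> is_derive u 1 s (h (s u))^-1.
Proof.
move=> oI iI ch h0.
have [sigma dsigma] := continuous_antiderivative oI iI ch.
have incr := derive_gt0_incr iI dsigma h0.
have inj t u : I t -> I u -> sigma t = sigma u -> t = u.
  move=> It Iu tu; have [] := ltgtP t u => //; first by move/(incr _ _ It Iu); rewrite tu ltxx.
  by move/(incr _ _ Iu It); rewrite tu ltxx.
(* The inverse of [sigma] on its image; the default value 0 is only taken off that image, which will
   be [J]. *)
pose s y := xget 0 [set t | I t /\ sigma t = y].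
have sK t : I t -> s (sigma t) = t.
  move=> It; rewrite /s; case: xgetP => [x -> [Ix]|/(_ t)]; first exact: inj.
  by case.
have nI t : I t -> \forall u \near t, I u by move=> It; exact: open_nbhs_nbhs.
have nsK t : I t -> {near t, cancel sigma s}.
  by move=> /nI; apply: filterS => u /sK.
have csigma t : I t -> {for t, continuous sigma}.
  by move=> /dsigma[ds _]; apply/differentiable_continuous/derivable1_diffP.
have ncsigma t : I t -> {near t, continuous sigma}.
  by move=> /nI; apply: filterS => u /csigma.
have ds t : I t -> is_derive (sigma t) 1 s (h t)^-1.
  move=> It; apply: is_derive_inverse; [exact: nsK|exact: ncsigma|exact: dsigma|].
  by rewrite gt_eqF// h0.
exists (sigma @` I), s; split; last first.
  by move=> _ [t It <-]; rewrite sK//; exact: ds.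
split.
(* A point [y] close to [sigma t] satisfies [sigma (s y) = y], and [s y] is in [I] by continuity of
   [s]; hence [y] is again in the image. *)
- rewrite openE => _ [t It <-]; rewrite /interior.
  have cs : {for sigma t, continuous s}.
    exact: nbhs_singleton (near_can_continuous (nsK _ It) (ncsigma _ It)).
  have := near_continuous_can_sym (ncsigma _ It) (nsK _ It).
  have : \forall y \near sigma t, I (s y).
    by apply: cs; rewrite sK//; exact: nI.
  by apply: filterS2 => y Isy yK; exists (s y).
- apply/connected_intervalP/connected_continuous_connected.
    exact/connected_intervalP.
  by apply: continuous_in_subspaceT => t; rewrite inE => /csigma.
- apply/seteqP; split => [_ [_ [t It <-] <-]|t It]; first by rewrite sK.
  by exists (sigma t); [exists t|rewrite sK].
- move=> _ [t It <-]; have [dst st] := ds _ It; split => //.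
  by rewrite derive1E st invr_gt0 h0.
Qed.

(** * Euler-Lagrange equations of a homogeneous Lagrangian *)

(** The difference quotients agree term by term, so the chain rule with a linear inner map is an
    identity at every point and can be used under a further derivative. *)
Lemma growth_rate_comp_linear (R : realType) (U V W : normedModType R)
    (r : {linear U -> V}) (g : V -> W) (z v : U) :
  (fun h : R => h^-1 *: ((g \o r \o shift z) (h *: v) - (g \o r) z)) =
  (fun h => h^-1 *: ((g \o shift (r z)) (h *: r v) - g (r z))).
Proof. by apply/funext => h /=; rewrite linearP. Qed.

Lemma derive_comp_linear (R : realType) (U V W : normedModType R)
    (r : {linear U -> V}) (g : V -> W) (z v : U) :
  'D_v (g \o r) z = 'D_(r v) g (r z).
Proof. by rewrite /derive growth_rate_comp_linear. Qed.

Lemma is_derive_comp_linear (R : realType) (U V W : normedModType R)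
    (r : {linear U -> V}) (g : V -> W) (z v : U) (dg : W) :
  is_derive (r z) (r v) g dg -> is_derive z v (g \o r) dg.
Proof.
by case=> dgr <-; split; [rewrite /derivable growth_rate_comp_linear|
  exact: derive_comp_linear].
Qed.

Lemma derive_sumZ (R : realType) (V W : normedModType R) (f : V -> W) (z : V)
    n (c : 'I_n -> R) (e : 'I_n -> V) :
  differentiable f z ->
  'D_(\sum_k c k *: e k) f z = \sum_k c k *: 'D_(e k) f z.
Proof.
move=> df; rewrite deriveE// linear_sum.
by apply: eq_bigr => k _; rewrite linearZ deriveE.
Qed.

Lemma derive_dirD (R : realType) (V W : normedModType R) (f : V -> W)
    (z u v : V) :
  differentiable f z -> 'D_(u + v) f z = 'D_u f z + 'D_v f z.
Proof. by move=> df; rewrite !deriveE// linearD. Qed.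

Lemma derive_dirZ (R : realType) (V W : normedModType R) (f : V -> W)
    (z v : V) (c : R) :
  differentiable f z -> 'D_(c *: v) f z = c *: 'D_v f z.
Proof. by move=> df; rewrite !deriveE// linearZ. Qed.

Section lagrangians.
Context (R : realType) (n : nat).
Notation V := 'rV[R]_n.
Implicit Types (U : set V) (f g : V * V -> R) (x y u v w : V) (z : V * V).

(** Unfolds to [slit_chart_image] when [U] is a chart image, which lets the local theory be
    developed without a manifold. *)
Definition slit U : set (V * V) := [set z | U z.1 /\ z.2 != 0].

Record C2_homogeneous U f : Prop := {
  C2_diff : forall z, slit U z -> differentiable f z ;
  C2_diff2 : forall z (v : V * V), slit U z -> differentiable ('D_v f) z ;
  C2_homog : forall x y (l : R), 0 < l -> f (x, l *: y) = l * f (x, y)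
}.

Lemma row_basis v : v = \sum_k v 0 k *: basis_vec R k.
Proof.
rewrite {1}[v]matrix_sum_delta big_ord1; apply: eq_bigr => k _.
by rewrite /basis_vec.
Qed.

Lemma pair_basis u w : (u, w) =
  (\sum_k u 0 k *: (basis_vec R k, 0 : V)) +
  (\sum_k w 0 k *: (0 : V, basis_vec R k)).
Proof.
have E1 (c : 'I_n -> R) : \sum_k c k *: (basis_vec R k, 0 : V) =
    (\sum_k c k *: basis_vec R k, 0).
  elim/big_rec2: _ => // k p q _ ->; congr pair => //=.
  by rewrite scaler0 addr0.
have E2 (c : 'I_n -> R) : \sum_k c k *: (0 : V, basis_vec R k) =
    (0, \sum_k c k *: basis_vec R k).
  elim/big_rec2: _ => // k p q _ ->; congr pair => //=.
  by rewrite scaler0 addr0.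
by rewrite E1 E2 -!row_basis; congr pair; rewrite ?addr0 ?add0r.
Qed.

Lemma derive_pairE f z u w : differentiable f z ->
  'D_(u, w) f z = \sum_k u 0 k * dx k f z + \sum_k w 0 k * dy k f z.
Proof.
by move=> df; rewrite pair_basis derive_dirD// !derive_sumZ.
Qed.

Lemma is_derive_coord z u w k :
  is_derive z (u, w) (fun p : V * V => p.2 0 k) (w 0 k).
Proof.
pose r (p : V * V) : R := p.2 0 k.
have lr : linear r by move=> c p q; rewrite /r !mxE.
pose rL : {linear _ -> _} := HB.pack r (GRing.isLinear.Build _ _ _ _ _ lr).
by apply: (@is_derive_comp_linear _ _ _ _ rL id); exact: is_derive_id.
Qed.

(** On the ray through [z] the function is affine in [l], with slope [c]. The case [a = 0] is
    Euler's identity in degree 1, the case [c = 0] the one in degree 0. *)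
Lemma derive_radial g z (a c : R) :
  (forall l : R, 0 < l -> g (z.1, l *: z.2) = a + l * c) ->
  'D_(0, z.2) g z = c.
Proof.
move=> gE.
have -> : 'D_(0, z.2) g z = 'D_1 (fun h : R => g (h *: (0, z.2) + z)) 0.
  rewrite /derive [in RHS](_ : (fun h : R => _ *: _) =
    fun h => h^-1 *: ((g \o shift z) (h *: (0, z.2)) - g z))//.
  by apply/funext => h /=; rewrite addr0 scale0r add0r [_%:A]mulr1.
rewrite (@near_eq_derive _ _ _ _ (fun h : R => (a + c) + h * c)); last first.
  near=> h.
  rewrite -[g _]/(g (h *: 0 + z.1, h *: z.2 + z.2)) scaler0 add0r.
  rewrite -{2}[z.2]scale1r -scalerDl gE; first by ring.
  (* The factor [h + 1] is positive as soon as [h > -1]. *)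
  rewrite -ltrBlDr sub0r; near: h; apply: lt_nbhsr; rewrite oppr_lt0; exact: ltr01.
have dh : is_derive (0 : R) 1 (fun h : R => h * c) c.
  have := is_deriveM (is_derive_id (0 : R) 1) (is_derive_cst c (0 : R) 1).
  by rewrite scaler0 add0r [c *: _]mulr1.
have := is_deriveD (is_derive_cst (a + c) (0 : R) 1) dh.
by rewrite add0r => -[].
Unshelve. all: by end_near. Qed.

Definition dilation (l : R) z : V * V := (z.1, l *: z.2).

Lemma dilation_linear l : linear (dilation l).
Proof.
by move=> c p q; congr pair => /=; rewrite scalerDr !scalerA mulrC.
Qed.
HB.instance Definition _ l :=
  GRing.isLinear.Build R (V * V)%type (V * V)%type _ (dilation l)
    (dilation_linear l).

(** Splits the motion of a reparametrized curve into [l] times the dilated old motion and a multiple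
    of the radial direction at the new velocity, to which Euler's identities apply. *)
Lemma reparam_accelE v w (l m : R) : 0 < l ->
  (l *: v, l ^+ 2 *: w + m *: v) =
  l *: (v, l *: w) + (m / l) *: (0 : V, l *: v).
Proof.
move=> l0; congr pair => /=; first by rewrite scaler0 addr0.
by rewrite !scalerA -expr2 divfK// gt_eqF.
Qed.

Lemma slit_dilation U z l : 0 < l -> slit U z -> slit U (dilation l z).
Proof.
by move=> l0 [Uz z0]; split => //=; rewrite scaler_eq0 negb_or z0 gt_eqF.
Qed.

Lemma open_slit U : open U -> open (slit U).
Proof.
move=> oU; have -> : slit U = (fst @^-1` U) `&` (snd @^-1` (~` [set 0])).
  apply/seteqP; split => z /= [Uz z0]; split => //; first exact/eqP.
  by apply/eqP.
apply: openI.
  by apply: open_comp => // z _; exact: cvg_fst.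
apply: open_comp; first by move=> z _; exact: cvg_snd.
exact/closed_openC/accessible_closed_set1/hausdorff_accessible/norm_hausdorff.
Qed.

Section homogeneous.
Variables (U : set V) (f : V * V -> R).
Hypotheses (oU : open U) (hf : C2_homogeneous U f).

Lemma near_slit z : slit U z -> \forall z' \near z, slit U z'.
Proof. by move=> sz; apply: open_nbhs_nbhs; split => //; exact: open_slit. Qed.

(** Differentiates the homogeneity relation [f \o dilation l = l *: f]. It follows that [dy k f] has
    degree 0 and [dx k f] degree 1 in the velocity. *)
Lemma derive_dilation z u v (l : R) : 0 < l -> slit U z ->
  'D_(u, l *: v) f (dilation l z) = l * 'D_(u, v) f z.
Proof.
move=> l0 sz; rewrite -[(u, l *: v)]/(dilation l (u, v)) -derive_comp_linear.
have -> : f \o dilation l = l *: f.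
  by apply/funext => -[x y]; exact: (C2_homog hf).
by rewrite deriveZ//; exact/diff_derivable/(C2_diff hf).
Qed.

Lemma dy_dilation k z (l : R) : 0 < l -> slit U z ->
  dy k f (dilation l z) = dy k f z.
Proof.
move=> l0 sz; have := derive_dilation 0 (basis_vec R k) l0 sz.
rewrite (_ : (0, _) = l *: (0 : V, basis_vec R k)); last first.
  by congr pair; rewrite scaler0.
rewrite derive_dirZ; last exact/(C2_diff hf)/slit_dilation.
by move/mulfI; apply; rewrite gt_eqF.
Qed.

Lemma dx_dilation k z (l : R) : 0 < l -> slit U z ->
  dx k f (dilation l z) = l * dx k f z.
Proof.
move=> l0 sz; have := derive_dilation (basis_vec R k) 0 l0 sz.
by rewrite scaler0.
Qed.

Lemma derive_dy_dilation k z u v (l : R) : 0 < l -> slit U z ->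
  'D_(u, l *: v) (dy k f) (dilation l z) = 'D_(u, v) (dy k f) z.
Proof.
move=> l0 sz; rewrite -[(u, l *: v)]/(dilation l (u, v)) -derive_comp_linear.
apply: near_eq_derive; apply: filterS (near_slit sz) => z'.
exact: dy_dilation.
Qed.

Lemma euler z : 'D_(0, z.2) f z = f z.
Proof.
rewrite (@derive_radial _ _ 0 (f z))// => l l0.
by rewrite (C2_homog hf)// add0r; case: z.
Qed.

Lemma euler_dy k z : slit U z -> 'D_(0, z.2) (dy k f) z = 0.
Proof.
move=> sz; rewrite (@derive_radial _ _ (dy k f z) 0)// => l l0.
by rewrite [LHS]dy_dilation// mulr0 addr0.
Qed.

Lemma euler_sum z : slit U z -> \sum_k z.2 0 k * dy k f z = f z.
Proof.
move=> sz; rewrite -[RHS]euler derive_pairE; last exact: (C2_diff hf).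
rewrite [X in _ = X + _](_ : _ = 0) ?add0r//.
by apply: big1 => k _; rewrite mxE mul0r.
Qed.

Lemma derivable_dy k z (v : V * V) : slit U z -> derivable (dy k f) z v.
Proof. by move=> sz; apply/diff_derivable/(C2_diff2 hf). Qed.

Lemma derivable_C2 z (v : V * V) : slit U z -> derivable f z v.
Proof. by move=> sz; apply/diff_derivable/(C2_diff hf). Qed.

(* Component [k] of d/dt f_{y^k} - f_{x^k} along a curve with position and
   velocity [z] and acceleration [w]. *)
Definition euler_lagrange f' k z w := 'D_(z.2, w) (dy k f') z - dx k f' z.

(** Differentiating Euler's identity [\sum_k y^k f_{y^k} = f] along the motion, the terms in the
    acceleration cancel on both sides. *)
Lemma euler_lagrange_radial z w : slit U z ->
  \sum_k z.2 0 k * euler_lagrange f k z w = 0.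
Proof.
move=> sz.
have dfz := C2_diff hf sz.
have near_euler : \forall z' \near z,
    (\sum_k (fun p : V * V => p.2 0 k) * dy k f) z' = f z'.
  apply: filterS (near_slit sz) => z' /euler_sum <-.
  by rewrite fct_sumE.
have : is_derive z (z.2, w) (\sum_k (fun p : V * V => p.2 0 k) * dy k f)
    (\sum_k (z.2 0 k *: 'D_(z.2, w) (dy k f) z + dy k f z *: w 0 k)).
  apply: is_derive_sum => k; apply: is_deriveM; first exact: is_derive_coord.
  exact/derivableP/derivable_dy.
move=> /(near_eq_is_derive near_euler)[_].
rewrite derive_pairE// big_split/=.
under [X in _ = _ + X]eq_bigr do rewrite /GRing.scale/= mulrC.
move=> /addIr xE.
under eq_bigr do rewrite mulrBr.
by rewrite sumrB xE subrr.
Qed.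

(** The Euler-Lagrange equations ignore oriented changes of parameter: the radial part of the
    acceleration is killed by [euler_dy], and the rest is homogeneous. *)
Lemma euler_lagrange_dilation k z w (l m : R) : 0 < l -> slit U z ->
  euler_lagrange f k (dilation l z) (l ^+ 2 *: w + m *: z.2) =
  l * euler_lagrange f k z w.
Proof.
move=> l0 sz; have sz' := slit_dilation l0 sz.
rewrite /euler_lagrange dx_dilation//= mulrBr (reparam_accelE _ _ _ l0).
congr (_ - _).
have dd : differentiable (dy k f) (dilation l z) by exact: (C2_diff2 hf).
rewrite (derive_dirD _ _ dd) !(derive_dirZ _ _ dd) (euler_dy k sz').
by rewrite (derive_dy_dilation k _ _ l0 sz) scaler0 addr0.
Qed.

(** By Euler's identity the radial part contributes [m * f z], so a suitable [m] keeps the speed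
    constant. *)
Lemma derive_dilation_accel z w (l m : R) : 0 < l -> slit U z ->
  'D_(l *: z.2, l ^+ 2 *: w + m *: z.2) f (dilation l z) =
  l ^+ 2 * 'D_(z.2, w) f z + m * f z.
Proof.
move=> l0 sz; have sz' := slit_dilation l0 sz.
have dd := C2_diff hf sz'.
rewrite (reparam_accelE _ _ _ l0) derive_dirD// !derive_dirZ// derive_dilation// (euler (dilation l z)).
rewrite (C2_homog hf)//; case: z sz {sz' dd} => x y sz /=.
by rewrite /GRing.scale/=; field; rewrite gt_eqF.
Qed.

End homogeneous.
End lagrangians.

(** * Geodesics in a chart *)

Lemma sum_leibniz (R : comPzRingType) n (p q c : R) (u w A B C D : 'I_n -> R) :
  c * (p * (\sum_l u l * A l + \sum_l w l * B l) +
       q * (\sum_l u l * C l + \sum_l w l * D l)) =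
  \sum_l u l * (c * (p * A l + q * C l)) +
  \sum_l w l * (c * (p * B l + q * D l)).
Proof.
have E (v X Y : 'I_n -> R) : \sum_l v l * (c * (p * X l + q * Y l)) =
    c * (p * (\sum_l v l * X l) + q * (\sum_l v l * Y l)).
  by rewrite !mulr_sumr -big_split/= mulr_sumr; apply: eq_bigr => l _; ring.
by rewrite !E; ring.
Qed.

Section local_geodesics.
Context (R : realType) (n : nat).
Notation V := 'rV[R]_n.
Implicit Types (U : set V) (f g : V * V -> R) (z : V * V) (w : V).

(** This and [local_spray] are [fundamental_tensor] and [spray_coef] for a function given in a
    chart; at [local_expr F i] they unfold to the same terms. *)
Definition energy_hessian f z : 'M[R]_n :=
  \matrix_(k, l) dy l (dy k (fun p => f p ^+ 2 / 2)) z.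

Definition local_spray f z : V :=
  let F2 := fun p => f p ^+ 2 in
  \row_k (4^-1 * \sum_l invmx (energy_hessian f z) k l *
           ((\sum_m dx m (dy l F2) z * z.2 0 m) - dx l F2 z)).

Lemma is_derive_sqr f z v :
  derivable f z v -> is_derive z v (fun p => f p ^+ 2) (2 * (f z * 'D_v f z)).
Proof.
move=> df; have -> : (fun p => f p ^+ 2) = f * f.
  by apply/funext => p; rewrite expr2.
apply: is_derive_eq (is_deriveM (derivableP df) (derivableP df)) _.
by rewrite mulrDl mul1r.
Qed.

Section homogeneous.
Variables (U : set V) (f : V * V -> R).
Hypotheses (oU : open U) (hf : C2_homogeneous U f).

Lemma derive_sqr z v : slit U z ->
  'D_v (fun p => f p ^+ 2) z = 2 * (f z * 'D_v f z).
Proof. by move=> sz; have [] := is_derive_sqr (v := v) (derivable_C2 hf sz). Qed.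

Lemma derive_dy_sqr k z v : slit U z ->
  'D_v (dy k (fun p => f p ^+ 2)) z =
  2 * (f z * 'D_v (dy k f) z + dy k f z * 'D_v f z).
Proof.
move=> sz.
have -> : 'D_v (dy k (fun p => f p ^+ 2)) z = 'D_v (2 *: (f * dy k f)) z.
  apply: near_eq_derive; apply: filterS (near_slit oU sz) => p sp.
  exact: derive_sqr.
have df : derivable f z v := derivable_C2 hf sz.
have ddf : derivable (dy k f) z v := derivable_dy hf sz.
by rewrite (deriveZ 2 (derivableM df ddf)) (deriveM df ddf).
Qed.

Lemma energy_hessianE k l z : slit U z ->
  energy_hessian f z k l = dy l (dy k (fun p => f p ^+ 2)) z / 2.
Proof.
move=> sz; rewrite mxE.
have df2 p v : slit U p -> derivable (fun p => f p ^+ 2) p v.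
  by move=> sp; have [] := is_derive_sqr (v := v) (derivable_C2 hf sp).
have -> : dy l (dy k (fun p => f p ^+ 2 / 2)) z =
    dy l (f * dy k f) z.
  apply: near_eq_derive; apply: filterS (near_slit oU sz) => p sp.
  rewrite /dy deriveMr; last exact: df2.
  by rewrite derive_sqr// mulKf// pnatr_eq0.
have df : derivable f z (0, basis_vec R l) := derivable_C2 hf sz.
have ddf : derivable (dy k f) z (0, basis_vec R l) := derivable_dy hf sz.
by rewrite /dy derive_dy_sqr// (deriveM df ddf) [RHS]mulrC mulKf// pnatr_eq0.
Qed.

(** The expansion in coordinates is made for [f] and [dy k f], which are differentiable by
    [C2_homogeneous], and transferred to the square by the product rule. *)
Lemma derive_dy_sqr_pairE k z (u w : V) : slit U z ->
  'D_(u, w) (dy k (fun p => f p ^+ 2)) z =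
  \sum_l u 0 l * dx l (dy k (fun p => f p ^+ 2)) z +
  \sum_l w 0 l * dy l (dy k (fun p => f p ^+ 2)) z.
Proof.
move=> sz; rewrite derive_dy_sqr//.
have df := C2_diff hf sz.
have ddf : differentiable (dy k f) z by exact: (C2_diff2 hf).
rewrite (derive_pairE _ _ df) (derive_pairE _ _ ddf).
have dxE l : dx l (dy k (fun p => f p ^+ 2)) z =
    2 * (f z * dx l (dy k f) z + dy k f z * dx l f z).
  exact: derive_dy_sqr.
have dyE l : dy l (dy k (fun p => f p ^+ 2)) z =
    2 * (f z * dy l (dy k f) z + dy k f z * dy l f z).
  exact: derive_dy_sqr.
under [X in _ = X + _]eq_bigr do rewrite dxE.
under [X in _ = _ + X]eq_bigr do rewrite dyE.
exact: sum_leibniz.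
Qed.

Lemma energy_hessian_prod k l z : slit U z ->
  energy_hessian f z k l = f z * dy l (dy k f) z + dy k f z * dy l f z.
Proof.
move=> sz; rewrite energy_hessianE// /dy derive_dy_sqr//.
by rewrite [LHS]mulrC mulKf// pnatr_eq0.
Qed.

Lemma euler_lagrange_sqr k z w : slit U z ->
  euler_lagrange (fun p => f p ^+ 2) k z w =
  2 * (dy k f z * 'D_(z.2, w) f z + f z * euler_lagrange f k z w).
Proof.
move=> sz; rewrite /euler_lagrange derive_dy_sqr// /dx derive_sqr//.
by rewrite -/(dx _ _ _); ring.
Qed.

(** The Hessian is [f f_{yy} + f_y f_y]. Contracted twice with the velocity, the first term vanishes
    since [f_y] has degree 0, and the second gives [f ^+ 2] by Euler's identity. *)
Lemma radial_energy_hessian z : slit U z ->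
  (z.2 *m energy_hessian f z *m z.2^T) 0 0 = f z ^+ 2.
Proof.
move=> sz; rewrite mxE.
have ez (l : 'I_n) : (z.2 *m energy_hessian f z) 0 l =
    \sum_k z.2 0 k * (f z * dy l (dy k f) z + dy k f z * dy l f z).
  rewrite mxE; apply: eq_bigr => k _; congr (_ * _).
  exact: energy_hessian_prod.
under eq_bigr do rewrite ez mxE mulr_suml.
rewrite exchange_big/=.
transitivity (\sum_k z.2 0 k * (f z * 'D_(0, z.2) (dy k f) z +
                                dy k f z * 'D_(0, z.2) f z)).
  apply: eq_bigr => k _.
  have ddf : differentiable (dy k f) z by exact: (C2_diff2 hf).
  rewrite (derive_pairE _ _ ddf) (derive_pairE _ _ (C2_diff hf sz)).
  rewrite [X in f z * (X + _)](_ : _ = 0); last first.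
    by apply: big1 => l _; rewrite mxE mul0r.
  rewrite [X in _ + dy k f z * (X + _)](_ : _ = 0); last first.
    by apply: big1 => l _; rewrite mxE mul0r.
  rewrite !add0r !mulr_sumr -big_split/= mulr_sumr; apply: eq_bigr => l _.
  by move: (dy l (dy k f) z) (dy k f z) (dy l f z) => d2 d1 d0; ring.
transitivity (\sum_k f z * (z.2 0 k * dy k f z)).
  apply: eq_bigr => k _; rewrite (euler_dy hf k sz) (euler hf).
  by rewrite mulr0 add0r; ring.
by rewrite -mulr_sumr (euler_sum hf)// expr2.
Qed.

(** The equations for the square form a linear system in the acceleration, with matrix twice the
    energy Hessian [H]; inverting [H] puts it in spray form. *)
Lemma spray_euler_lagrange z w :
  slit U z -> energy_hessian f z \in unitmx ->
  w + 2 *: local_spray f z = 0 <->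
  forall k, euler_lagrange (fun p => f p ^+ 2) k z w = 0.
Proof.
move=> sz uH; set H := energy_hessian f z in uH *.
pose q : 'cV[R]_n := \col_l
  (\sum_m dx m (dy l (fun p => f p ^+ 2)) z * z.2 0 m -
   dx l (fun p => f p ^+ 2) z).
(* The factor is [2 * 4^-1]. *)
have sprayE : 2 *: local_spray f z = 2^-1 *: (invmx H *m q)^T.
  apply/rowP => k; rewrite !mxE mulrA; congr (_ * _); first by field.
  by apply: eq_bigr => l _; rewrite !mxE.
have elE k : euler_lagrange (fun p => f p ^+ 2) k z w =
    2 * (H *m w^T + 2^-1 *: q) k 0.
  rewrite /euler_lagrange derive_dy_sqr_pairE// !mxE mulrDr mulVKf//.
  rewrite addrAC addrC; congr (_ + _).
    rewrite mulr_sumr; apply: eq_bigr => l _.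
    by rewrite energy_hessianE// mxE; field.
  by congr (_ - _); apply: eq_bigr => l _; rewrite mulrC.
rewrite sprayE; split => [wE k|elw].
  rewrite elE.
  have -> : w^T = - (2^-1 *: (invmx H *m q)).
    by move/eqP: wE; rewrite addr_eq0 => /eqP ->; rewrite linearN/= linearZ/= trmxK.
  by rewrite mulmxN -scalemxAr mulKVmx// addNr mxE mulr0.
have : H *m w^T + 2^-1 *: q = 0.
  apply/colP => k; rewrite [RHS]mxE.
  by have /eqP := elw k; rewrite elE mulf_eq0 pnatr_eq0/= => /eqP.
move=> /(congr1 (fun A => (invmx H *m A)^T)).
by rewrite mulmxDr mulKmx// mulmx0 trmx0 linearD/= trmxK -scalemxAr linearZ.
Qed.

(* The contraction of the equations with the velocity is f * df/dt, so that
   geodesics have constant speed. *)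
Lemma spray_constant_speed z w :
  slit U z -> energy_hessian f z \in unitmx -> 0 < f z ->
  w + 2 *: local_spray f z = 0 <->
  'D_(z.2, w) f z = 0 /\ forall k, euler_lagrange f k z w = 0.
Proof.
move=> sz uH f0; rewrite spray_euler_lagrange//; split => [el2|[df el] k].
  have el k : dy k f z * 'D_(z.2, w) f z + f z * euler_lagrange f k z w = 0.
    have /eqP := el2 k.
    by rewrite euler_lagrange_sqr// mulf_eq0 pnatr_eq0/= => /eqP.
  have df : 'D_(z.2, w) f z = 0.
    have : \sum_k z.2 0 k *
        (dy k f z * 'D_(z.2, w) f z + f z * euler_lagrange f k z w) = 0.
      by apply: big1 => k _; rewrite el mulr0.
    under eq_bigr do rewrite mulrDr mulrA [_ * (f z * _)]mulrCA.
    rewrite big_split/= -mulr_suml -mulr_sumr (euler_sum hf)//.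
    rewrite (euler_lagrange_radial oU hf)// mulr0 addr0.
    by move/eqP; rewrite mulf_eq0 gt_eqF//= => /eqP.
  split => // k; have /eqP := el k.
  by rewrite df mulr0 add0r mulf_eq0 gt_eqF//= => /eqP.
by rewrite euler_lagrange_sqr// df el !mulr0 addr0 mulr0.
Qed.

End homogeneous.

Definition local_form (b : 'I_n -> V -> R) z := \sum_k z.2 0 k * b k z.1.

(** * Adding a closed 1-form to the Lagrangian *)

Section change_by_closed_form.
Variables (U : set V) (f f' : V * V -> R) (b : 'I_n -> V -> R).
Hypotheses (oU : open U) (hf : C2_homogeneous U f).
Hypotheses (f'E : forall z, f' z = f z + local_form b z).
Hypotheses (db : forall k x, U x -> differentiable (b k) x).
Hypotheses (cb : forall k l x, U x ->
  'D_(basis_vec R k) (b l) x = 'D_(basis_vec R l) (b k) x).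

Let fstL : {linear (V * V)%type -> V} := fst.

Lemma is_derive_local_form z u w : U z.1 ->
  is_derive z (u, w) (local_form b)
    (\sum_k (w 0 k * b k z.1 + z.2 0 k * 'D_u (b k) z.1)).
Proof.
move=> Uz.
have -> : local_form b = \sum_k (fun p : V * V => p.2 0 k) * (b k \o fst).
  by apply/funext => p; rewrite fct_sumE.
apply: is_derive_sum => k.
have dbk : is_derive z (u, w) (b k \o fst) ('D_u (b k) z.1).
  apply: (@is_derive_comp_linear _ _ _ _ fstL (b k) z (u, w)).
  exact/derivableP/diff_derivable/db.
apply: is_derive_eq (is_deriveM (is_derive_coord z u w k) dbk) _.
by rewrite addrC; congr (_ + _); exact: mulrC.
Qed.

Lemma derive_change z u w : slit U z ->
  'D_(u, w) f' z =
  'D_(u, w) f z + \sum_k (w 0 k * b k z.1 + z.2 0 k * 'D_u (b k) z.1).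
Proof.
move=> sz; have -> : f' = f + local_form b by apply/funext.
have [db' <-] := is_derive_local_form u w sz.1.
exact: (deriveD (derivable_C2 hf sz) db').
Qed.

Lemma dy_change k z : slit U z -> dy k f' z = dy k f z + b k z.1.
Proof.
move=> sz; rewrite /dy derive_change//; congr (_ + _).
rewrite (bigD1 k)//= derive0 mulr0 addr0 mxE !eqxx mul1r big1 ?addr0// => l lk.
by rewrite derive0 mulr0 addr0 mxE (negbTE lk) andbF mul0r.
Qed.

(** The form adds [y^l d_l b_k] to the first term of the equation and [y^l d_k b_l] to the second;
    closedness makes the two cancel. *)
Lemma euler_lagrange_change k z w : slit U z ->
  euler_lagrange f' k z w = euler_lagrange f k z w.
Proof.
move=> sz; have Uz := sz.1.
have dyE : 'D_(z.2, w) (dy k f') z =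
    'D_(z.2, w) (dy k f) z + 'D_(z.2) (b k) z.1.
  rewrite (@near_eq_derive _ _ _ _ (dy k f + (b k \o fst))); last first.
    by apply: filterS (near_slit oU sz) => p; exact: dy_change.
  have dbk : is_derive z (z.2, w) (b k \o fst) ('D_(z.2) (b k) z.1).
    apply: (@is_derive_comp_linear _ _ _ _ fstL (b k) z (z.2, w)).
    exact/derivableP/diff_derivable/db.
  have [dbk1 <-] := dbk; exact: (deriveD (derivable_dy hf sz) dbk1).
rewrite /euler_lagrange dyE /dx derive_change// opprD addrACA.
rewrite -[RHS]addr0; congr (_ + _); apply/eqP; rewrite subr_eq0; apply/eqP.
rewrite {1}[z.2]row_basis derive_sumZ; last exact: db.
apply: eq_bigr => l _; rewrite mxE mul0r add0r.
by congr (_ * _); exact: cb.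
Qed.

End change_by_closed_form.

(* If [y], [w] are the velocity and acceleration of a geodesic of [f], then
   [l y], [l^2 w + m y] are those of its reparametrization to unit [f']-speed:
   here [l = 1 / f'] and [m = l dl/dt]. *)
Lemma geodesic_change U f f' (b : 'I_n -> V -> R) z w :
  open U -> C2_homogeneous U f -> C2_homogeneous U f' ->
  (forall p, f' p = f p + local_form b p) ->
  (forall k x, U x -> differentiable (b k) x) ->
  (forall k l x, U x ->
    'D_(basis_vec R k) (b l) x = 'D_(basis_vec R l) (b k) x) ->
  (forall p, slit U p -> 0 < f p) -> (forall p, slit U p -> 0 < f' p) ->
  (forall p, slit U p -> energy_hessian f p \in unitmx) ->
  (forall p, slit U p -> energy_hessian f' p \in unitmx) ->
  slit U z -> w + 2 *: local_spray f z = 0 ->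
  let l := (f' z)^-1 in
  let w' := l ^+ 2 *: w + (- (l ^+ 3 * 'D_(z.2, w) f' z)) *: z.2 in
  w' + 2 *: local_spray f' (z.1, l *: z.2) = 0.
Proof.
move=> oU hf hf' f'E db cb f0 f'0 uH uH' sz.
move=> /(spray_constant_speed oU hf w sz (uH _ sz) (f0 _ sz))[_ el] l w'.
have l0 : 0 < l by rewrite invr_gt0 f'0.
have sz' := slit_dilation l0 sz.
apply/(spray_constant_speed oU hf' w' sz' (uH' _ sz') (f'0 _ sz')); split.
  (* With [D] the derivative of [f'] along the old motion, [l ^+ 2 * D - l ^+ 3 * D * f' z] vanishes
     because [l * f' z = 1]. *)
  rewrite (derive_dilation_accel hf' _ _ l0 sz) /l.
  by field; rewrite gt_eqF// f'0.
move=> k; rewrite (euler_lagrange_dilation oU hf' _ _ _ l0 sz).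
by rewrite (euler_lagrange_change oU hf f'E)// el mulr0.
Qed.

End local_geodesics.

(** * Reversal of the velocity *)

Section reversal.
Context (R : realType) (n : nat).
Notation V := 'rV[R]_n.

Definition flip (z : V * V) : V * V := (z.1, - z.2).

Lemma flip_linear : linear flip.
Proof.
by move=> c p q; congr pair => /=; rewrite opprD scalerN.
Qed.
HB.instance Definition _ :=
  GRing.isLinear.Build R (V * V)%type (V * V)%type _ flip flip_linear.

Variables (U : set V) (f : V * V -> R).
Hypotheses (oU : open U) (hf : C2_homogeneous U f).

Lemma slit_flip z : slit U z -> slit U (flip z).
Proof. by case=> Uz z0; split => //=; rewrite oppr_eq0. Qed.

Lemma flip_differentiable (W : normedModType R) (g : V * V -> W) z :
  differentiable g (flip z) -> differentiable (g \o flip) z.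
Proof.
move=> dg; apply: differentiable_comp => //.
have dfst : differentiable (fst : V * V -> V) z.
  by apply: linear_differentiable => p; exact: cvg_fst.
have dsnd : differentiable (snd : V * V -> V) z.
  by apply: linear_differentiable => p; exact: cvg_snd.
exact: differentiable_pair dfst (differentiableN dsnd).
Qed.

Lemma C2_homogeneous_flip : C2_homogeneous U (f \o flip).
Proof.
split.
- move=> z sz; exact: flip_differentiable (C2_diff hf (slit_flip sz)).
- move=> z v sz.
  have -> : 'D_v (f \o flip) = 'D_(flip v) f \o flip.
    by apply/funext => p; exact: derive_comp_linear.
  exact: flip_differentiable (C2_diff2 hf _ (slit_flip sz)).
- by move=> x y l l0; rewrite /= /flip/= -scalerN (C2_homog hf).
Qed.

Lemma dy_flip (g : V * V -> R) k z : differentiable g (flip z) ->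
  dy k (g \o flip) z = - dy k g (flip z).
Proof.
move=> dg; rewrite /dy derive_comp_linear.
rewrite [X in 'D_X _ _](_ : _ = -1 *: (0 : V, basis_vec R k)); last first.
  by congr pair => /=; rewrite ?scaler0 ?scaleN1r.
by rewrite (derive_dirZ _ _ dg) scaleN1r.
Qed.

(** Each vertical derivative changes sign under [flip], and both terms of [energy_hessian_prod]
    contain two of them. *)
Lemma energy_hessian_flip z : slit U z ->
  energy_hessian (f \o flip) z = energy_hessian f (flip z).
Proof.
move=> sz; have sz' := slit_flip sz; apply/matrixP => k l.
have dkf := dy_flip k (C2_diff hf sz'); have dlf := dy_flip l (C2_diff hf sz').
have dlkf : dy l (dy k (f \o flip)) z = dy l (dy k f) (flip z).
  have ddf : differentiable (dy k f) (flip z) by exact: (C2_diff2 hf).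
  transitivity (dy l ((- dy k f) \o flip) z).
    apply: near_eq_derive; apply: filterS (near_slit oU sz) => p sp.
    by apply: dy_flip; exact: (C2_diff hf (slit_flip sp)).
  rewrite (dy_flip l (differentiableN ddf)).
  by rewrite /dy (deriveN (diff_derivable ddf)) opprK.
apply: etrans (energy_hessian_prod oU C2_homogeneous_flip k l sz) _.
apply: etrans (esym (energy_hessian_prod oU hf k l sz')).
by rewrite dlkf dkf dlf mulrNN.
Qed.

End reversal.

(** * Derivatives along curves *)

Section curves.
Context (R : realType).

Lemma is_derive_curve_comp (V W : normedModType R) (x : R -> V) (g : V -> W) t :
  derivable x t 1 -> differentiable g (x t) ->
  is_derive t 1 (g \o x) ('D_(derive1 x t) g (x t)).
Proof.
move=> /derivable1_diffP dx dg; split.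
  exact/derivable1_diffP/differentiable_comp.
rewrite -derive1E derive1E'; last exact: differentiable_comp.
by rewrite diff_comp//= deriveE// derive1E'.
Qed.

Lemma is_derive_reparam (V : normedModType R) (x : R -> V) (s : R -> R) (u ds : R) :
  is_derive u 1 s ds -> derivable x (s u) 1 ->
  is_derive u 1 (x \o s) (ds *: derive1 x (s u)).
Proof.
move=> [dsu dsE] /derivable1_diffP dx.
have := is_derive_curve_comp dsu dx.
by rewrite deriveE// diff1E// derive1E dsE.
Qed.

Lemma is_derive_pair (V W : normedModType R) (x : R -> V) (y : R -> W) (t : R) :
  derivable x t 1 -> derivable y t 1 ->
  is_derive t 1 (fun u => (x u, y u)) (derive1 x t, derive1 y t).
Proof.
move=> /derivable1_diffP dx /derivable1_diffP dy.
have d := differentiable_pair dx dy.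
split; first exact: (derivable1_diffP _ _).2 d.
by rewrite (deriveE _ d) (diff_pair dx dy) (derive1E' dx) (derive1E' dy).
Qed.

(** Reduces, entry by entry, to the product rule for real functions. *)
Lemma is_derive_scale n (k : R -> R) (x : R -> 'rV[R]_n) (t dk : R) dx :
  is_derive t 1 k dk -> is_derive t 1 x dx ->
  is_derive t 1 (fun u => k u *: x u) (k t *: dx + dk *: x t).
Proof.
move=> hk [hx <-].
have hxi i j := (derivable_mxP x t 1).1 hx i j.
have hkx i j : is_derive t 1 (fun u => (k u *: x u) i j)
    (k t * 'D_1 (fun u => x u i j) t + x t i j * dk).
  have -> : (fun u => (k u *: x u) i j) = k * (fun u => x u i j).
    by apply/funext => u; rewrite mxE.
  exact: is_deriveM hk (derivableP (hxi i j)).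
have hkxt : derivable (fun u => k u *: x u) t 1.
  by apply/derivable_mxP => i j; case: (hkx i j).
split => //; rewrite derive_mx//; apply/matrixP => i j; rewrite mxE.
have [_ ->] := hkx i j.
have <- : 'D_1 x t i j = 'D_1 (fun u => x u i j) t by rewrite (derive_mx hx) mxE.
by rewrite [RHS]mxE; congr (_ + _); rewrite mxE// mulrC.
Qed.

End curves.

(** * Geodesics on the manifold *)

Section manifolds.
Context (R : realType) (n : nat) (M : topologicalType) (X : smooth_manifold R n M).
Notation V := 'rV[R]_n.
Implicit Types (F : TM_fun R n M) (i j : chart_idx X).
Local Notation chart_im i := (chart i @` chart_dom i).

(** What the comparison of geodesics uses of a Finsler metric, convexity being weakened to
    invertibility of the Hessian. These properties pass to the reverse metric through [flip]. *)
Record lagrangian F : Prop := {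
  lagrangian_C2 : forall i, C2_homogeneous (chart_im i) (local_expr F i) ;
  lagrangian_gt0 : forall i z, slit (chart_im i) z -> 0 < local_expr F i z ;
  lagrangian_unit : forall i z, slit (chart_im i) z ->
    energy_hessian (local_expr F i) z \in unitmx
}.

Lemma positive_definite_unitmx (A : 'M[R]_n) :
  positive_definite A -> A \in unitmx.
Proof.
move=> pA; rewrite -row_free_unit -kermx_eq0; apply/rowV0P => v /sub_kermxP vA.
apply/eqP; apply: contraT => /pA; by rewrite vA mul0mx mxE ltxx.
Qed.

(** Strict positivity comes from convexity: positive definiteness tested on the velocity itself
    says, by [radial_energy_hessian], that the square of [F] is positive. *)
Lemma finsler_lagrangian F : finsler_metric X F -> lagrangian F.
Proof.
move=> hF.
have hC i : C2_homogeneous (chart_im i) (local_expr F i).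
  have [/= h1 h2] := finsler_smooth hF i 2%N.
  split => [z sz|z v sz|x y l l0]; first exact: h1.
    by have [h _] := h2 v; exact: h.
  by rewrite /local_expr/= /tvec linearZ (finsler_homogeneous hF).
split=> // i z sz.
  have f2 : 0 < local_expr F i z ^+ 2.
    rewrite -(radial_energy_hessian (@chart_image_open _ _ _ X i) (hC i) sz).
    by apply: (finsler_convex hF sz); case: sz.
  rewrite lt_neqAle (finsler_ge0 hF) andbT eq_sym.
  by apply: contraTneq f2 => ->; rewrite expr0n ltxx.
exact/positive_definite_unitmx/(finsler_convex hF).
Qed.

Lemma local_expr_reverse F i :
  local_expr (reverse_metric F) i = local_expr F i \o @flip R n.
Proof.
by apply/funext => z; rewrite /local_expr/reverse_metric/= /tvec linearN.
Qed.

Lemma lagrangian_reverse F : lagrangian F -> lagrangian (reverse_metric F).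
Proof.
move=> hF; split=> i; rewrite local_expr_reverse.
- exact: C2_homogeneous_flip (lagrangian_C2 hF i).
- by move=> z /slit_flip sz; exact: (lagrangian_gt0 hF).
- move=> z sz.
  rewrite (energy_hessian_flip (@chart_image_open _ _ _ X i) (lagrangian_C2 hF i))//.
  exact/(lagrangian_unit hF)/slit_flip.
Qed.

Lemma local_expr_form (b : one_form X) i z :
  local_expr b i z = local_form (form_comp b i) z.
Proof.
rewrite /local_expr /local_form /form_comp {1}[z.2]row_basis.
pose bL : {linear V -> R^o} :=
  HB.pack (form_val b (chart_inv i z.1))
    (GRing.isLinear.Build _ _ _ _ _ (form_linear b (chart_inv i z.1))).
rewrite /tvec linear_sum -[LHS]/(bL _) linear_sum; apply: eq_bigr => k _.
by rewrite !linearZ.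
Qed.

Section curve.
Variables (I : set R) (c : R -> M) (i : chart_idx X) (t : R).
Hypotheses (oI : open I) (cc : forall t, I t -> {for t, continuous c}).
Hypotheses (It : I t) (ct : chart_dom i (c t)).

Lemma near_curve_chart : \forall u \near t, I u /\ chart_dom i (c u).
Proof.
near=> u; split; near: u; first exact: open_nbhs_nbhs.
apply: (cc It); apply: open_nbhs_nbhs; split => //.
exact: chart_dom_open.
Unshelve. all: by end_near. Qed.

(* The velocity in the chart [i] and the one in the preferred chart of [c t]
   represent the same tangent vector. *)
Lemma tvec_velocity : derivable (chart i \o c) t 1 ->
  tvec i (chart i (c t)) (derive1 (chart i \o c) t) =
  derive1 (chart (chart_at X (c t)) \o c) t.
Proof.
move=> dx; rewrite /tvec chartK//; set j := chart_at X (c t).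
have dij : differentiable (chart j \o chart_inv i) (chart i (c t)).
  have [h _] := chart_transition_smooth i j 1%N; apply: h.
  by exists (c t) => //; split => //; exact: chart_at_dom.
have [_ chain] := is_derive_curve_comp dx dij.
rewrite -(deriveE _ dij) [RHS]derive1E; apply: etrans (esym chain) _.
apply: near_eq_derive; apply: filterS near_curve_chart => u [_ cu].
by rewrite /= chartK.
Qed.

End curve.

(** * Geodesics reparametrized by the arc length of another metric *)

Section reparametrization.
Variables (F F' : TM_fun R n M) (b : one_form X) (r : R).
Hypotheses (hF : lagrangian F) (hF' : lagrangian F').
Hypotheses (F'E : forall p v, F' p v = F p v + r * b p v).
Hypotheses (cb : closed_form b).

(** The new parameter is the arc length for [F']; in each chart the claim then becomes
    [geodesic_change]. *)
Lemma geodesic_reparametrization I c : geodesic X F I c ->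
  exists J s, reparametrization J I s /\ geodesic X F' J (c \o s).
Proof.
move=> [oI iI cc gc].
(* Defined through preferred charts, the speed is independent of [i], so one change of parameter
   serves all charts. Since the preferred chart varies with [t], differentiation goes through the
   expression [speedE] in a fixed chart. *)
pose speed t := F' (c t) (derive1 (chart (chart_at X (c t)) \o c) t).
pose z i t := ((chart i \o c) t, derive1 (chart i \o c) t).
have slitz i t : I t -> chart_dom i (c t) -> slit (chart_im i) (z i t).
  by move=> It ct; have [_ _ x0 _] := gc i t It ct; split => //; exists (c t).
have speedE i t : I t -> chart_dom i (c t) -> speed t = local_expr F' i (z i t).
  move=> It ct; have [dx _ _ _] := gc i t It ct.
  by rewrite /local_expr /= chartK// (tvec_velocity oI cc It ct dx).
have dspeed i t : I t -> chart_dom i (c t) -> is_derive t 1 speed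
    ('D_(derive1 (chart i \o c) t, derive1 (derive1 (chart i \o c)) t)
       (local_expr F' i) (z i t)).
  move=> It ct; have [dx ddx _ _] := gc i t It ct.
  apply: (@near_eq_is_derive _ _ _ (local_expr F' i \o z i)).
    apply: filterS (near_curve_chart oI cc It ct) => u [Iu cu].
    by rewrite (speedE i).
  have [dz dz1] := is_derive_pair dx ddx.
  have dzE := etrans (derive1E (z i) t) dz1.
  have dF' := C2_diff (lagrangian_C2 hF' i) (slitz i t It ct).
  have := is_derive_curve_comp dz dF'.
  by rewrite dzE.
have cspeed t : I t -> {for t, continuous speed}.
  move=> It; have [ds _] := dspeed _ t It (chart_at_dom X (c t)).
  exact/differentiable_continuous/derivable1_diffP.
have speed0 t : I t -> 0 < speed t.
  move=> It; have ct := chart_at_dom X (c t).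
  by rewrite (speedE _ _ It ct); exact/(lagrangian_gt0 hF')/slitz.
have [J [s [rs ds]]] := speed_reparametrization oI iI cspeed speed0.
exists J, s; split => //; have [oJ iJ sJ _] := rs.
have Is u : J u -> I (s u) by move=> Ju; rewrite -sJ; exists u.
have ccs u : J u -> {for u, continuous (c \o s)}.
  move=> Ju; apply: continuous_comp; last exact/cc/Is.
  by have [dsu _] := ds u Ju; exact/differentiable_continuous/derivable1_diffP.
split => // i u Ju csu x.
have xE v : J v -> chart_dom i (c (s v)) ->
    is_derive v 1 x ((speed (s v))^-1 *: derive1 (chart i \o c) (s v)).
  move=> Jv csv; have [dx _ _ _] := gc i _ (Is _ Jv) csv.
  exact: (is_derive_reparam (ds v Jv) dx).
have x'E v : J v -> chart_dom i (c (s v)) ->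
    derive1 x v = (speed (s v))^-1 *: derive1 (chart i \o c) (s v).
  by move=> Jv csv; have [_ <-] := xE v Jv csv; exact: derive1E.
have [dx ddx x0 geo] := gc i _ (Is _ Ju) csu.
set l := (speed (s u))^-1; have l0 : l != 0.
  by rewrite invr_eq0 gt_eqF// speed0//; exact: Is.
have sz := slitz i _ (Is _ Ju) csu.
set D := 'D_(derive1 (chart i \o c) (s u), derive1 (derive1 (chart i \o c)) (s u))
  (local_expr F' i) (z i (s u)).
have x''E : is_derive u 1 (derive1 x)
    (l ^+ 2 *: derive1 (derive1 (chart i \o c)) (s u) +
     - (l ^+ 3 * D) *: derive1 (chart i \o c) (s u)).
  apply: (@near_eq_is_derive _ _ _
    (fun v => (speed (s v))^-1 *: derive1 (chart i \o c) (s v))).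
    by apply: filterS (near_curve_chart oJ ccs Ju csu) => v [Jv csv]; rewrite x'E.
  (* Here [dl/du] is [- l ^+ 2] times the derivative [l * D] of the speed in the new parameter. *)
  have dl : is_derive u 1 (fun v => (speed (s v))^-1) (- (l ^+ 3 * D)).
    have dsp : is_derive u 1 (speed \o s) (l * D).
      have [dspeed1 dspeed2] := dspeed i _ (Is _ Ju) csu.
      have := is_derive_reparam (ds u Ju) dspeed1.
      by rewrite derive1E dspeed2.
    have [dsp1 dsp2] := dsp.
    have sp0 : (speed \o s) u != 0 by rewrite gt_eqF// speed0//; exact: Is.
    split; first exact: derivableV.
    rewrite (deriveV sp0 dsp1) dsp2 /= -exprVn -/l /GRing.scale/=.
    by rewrite mulNr; congr (- _); ring.
  have dx' := is_derive_reparam (ds u Ju) ddx.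
  apply: is_derive_eq (is_derive_scale dl dx') _.
  by rewrite scalerA -expr2.
have x''E1 : derive1 (derive1 x) u =
    l ^+ 2 *: derive1 (derive1 (chart i \o c)) (s u) +
    - (l ^+ 3 * D) *: derive1 (chart i \o c) (s u).
  by have [_ <-] := x''E; exact: derive1E.
split; [by case: (xE u Ju csu)|by case: x''E| |].
  by rewrite (x'E u Ju csu) scaler_eq0 negb_or l0.
rewrite x''E1 (x'E u Ju csu).
(* The scalar [r] is absorbed into the components, so that [geodesic_change] sees a single closed
   form. *)
have FE p : local_expr F' i p =
    local_expr F i p + local_form (fun k => r *: form_comp b i k) p.
  rewrite /local_expr F'E -/(local_expr b i p) local_expr_form; congr (_ + _).
  by rewrite /local_form mulr_sumr; apply: eq_bigr => k _; rewrite [RHS]mulrCA.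
have db k y : chart_im i y -> differentiable (form_comp b i k) y.
  by have [h _] := form_smooth b i k 1%N; exact: h.
have := geodesic_change (@chart_image_open _ _ _ X i) (lagrangian_C2 hF i)
  (lagrangian_C2 hF' i) FE _ _ (@lagrangian_gt0 _ hF i) (@lagrangian_gt0 _ hF' i)
  (@lagrangian_unit _ hF i) (@lagrangian_unit _ hF' i) sz geo.
rewrite /= -(speedE i _ (Is _ Ju) csu); apply.
- by move=> k y Uy; apply: differentiableZ; exact: db.
- move=> k l' y Uy; rewrite !deriveZ; [|exact/diff_derivable/db..].
  by rewrite cb.
Qed.

End reparametrization.

(* Here [F = G + r b] with [G = alpha (s^2 + d)] even in the velocity. *)
Lemma alpha_beta_reverse (a : riemannian_metric X) (b : one_form X) F r d :
  (forall p v, F p v = riemannian_norm a p v *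
    ((b p v / riemannian_norm a p v) ^+ 2 +
      r * (b p v / riemannian_norm a p v) + d)) ->
  forall p v, reverse_metric F p v = F p v - 2 * r * b p v.
Proof.
move=> FE p v.
pose aL u : {linear V -> R^o} :=
  HB.pack (inner a p u) (GRing.isLinear.Build _ _ _ _ _ (inner_linear a p u)).
pose bL : {linear V -> R^o} :=
  HB.pack (form_val b p) (GRing.isLinear.Build _ _ _ _ _ (form_linear b p)).
have aN : riemannian_norm a p (- v) = riemannian_norm a p v.
  rewrite /riemannian_norm; congr Num.sqrt.
  rewrite -[LHS]/(aL (- v) (- v)) linearN /= inner_sym -[inner _ _ _ _]/(aL v (- v)).
  by rewrite linearN opprK.
have bN : b p (- v) = - b p v by rewrite -[LHS]/(bL (- v)) linearN.
rewrite /reverse_metric !FE aN bN.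
(* Off the zero section the norm cancels in [alpha * (beta / alpha) = beta]; at [v = 0] the form
   vanishes and both sides agree. *)
have [->|v0] := eqVneq v 0.
  by rewrite -[b p 0]/(bL 0) linear0 oppr0 mulr0 subr0.
have : riemannian_norm a p v != 0 by rewrite gt_eqF// sqrtr_gt0 inner_pos.
by move: (riemannian_norm a p v) (b p v) => x y x0; field.
Qed.

End manifolds.

Theorem theorem3p4 (R : realType) (n : nat) (M : topologicalType)
    (X : smooth_manifold R n M) (phi : R -> R) (a : riemannian_metric X)
    (b : one_form X) (F : TM_fun R n M)
    (hn : (3 <= n)%N)
    (hconn : connected [set: M])
    (hF : alpha_beta_metric phi a b F)
    (hnonriem : ~ is_riemannian X F)
    (hclosed : closed_form b)
    (hphi : (forall s, phi s = s ^+ 2 + 2 * s + 2) \/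
            (forall s, phi s = s ^+ 2 + s + 2) \/
            (forall s, phi s = (s + 2) ^+ 2)) :
  reversible_geodesics X F.
Proof.
have [/finsler_lagrangian lF _ _ FE] := hF.
have lrF := lagrangian_reverse lF.
(* The pairs [(r, d)] are [(2, 2)], [(1, 2)] and, expanding the square, [(4, 4)]. *)
have [r [d phiE]] : exists r d, forall s, phi s = s ^+ 2 + r * s + d.
  case: hphi => [|[|]] phiE; [exists 2, 2|exists 1, 2|exists 4, 4] => s;
    by rewrite phiE; ring.
have rFE : forall p v, reverse_metric F p v = F p v - 2 * r * b p v.
  by apply: alpha_beta_reverse => p v; rewrite FE phiE.
(* The two directions are the same lemma, with the closed form added once with factor [- (2 * r)]
   and once with [2 * r]. *)
split => I c.
  apply: (geodesic_reparametrization (b := b) (r := - (2 * r))) => // p v.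
  by rewrite rFE mulNr.
apply: (geodesic_reparametrization (b := b) (r := 2 * r)) => // p v.
by rewrite rFE subrK.
Qed.
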